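(* Let $H:=(\mathbb{Z}/p^{\eta}\mathbb{Z},+)$ be endowed with the trivial linear cycle set structure and let $I:=\mathbb{Z}/p^{r}\mathbb{Z}$. Assume $r\le\eta$ if $p$ is odd, and $r\le\min(2,\eta)$ if $p=2$. Let $\diamond$ be an action of $H$ on $I$. There exists $0\le k<p^{r-1}$ such that $$h\diamond y=(1+pk)^{h}y=\sum_{i=0}^{h}\binom{h}{i}p^{i}k^{i}y,$$ and there are two cases: ($k=0$) The set $\{(z_1,z_2):0\le z_1,z_2<p^{r}\}$ of pairs $(f_0,\gamma)$ parametrizes a complete family $(\alpha_1(\gamma),f_{f_0})$ of representatives of 2-cocycles modulo coboundaries. Moreover $f_{f_0}(h,h')=f_0hh'$. ($k\ne0$) Write $k=p^{u}s$ with $0\le u<r-1$ and $p\nmid s$. The set $\{(z_1,p^{r-u-1}z_2):0\le z_1,z_2<p^{u+1}\}$ of pairs $(f_0,\gamma)$ parametrizes a complete family $(\alpha_1(\gamma),f_{f_0})$ of representatives of 2-cocycles modulo coboundaries. Moreover $f_{f_0}(h,h')=\sum_{l=0}^{h-1}\binom{h}{l+1}p^{(u+1)l}s^{l}f_0h'$.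
   Context: $p$ is a prime, $\eta\ge1$ and $r\ge1$ are integers. The trivial linear cycle set structure on $H$ is $i\cdot j:=j$. Elements $h,h'\in H$ are identified with their integer representatives in $\{0,\dots,p^{\eta}-1\}$; integers are viewed in $I$ through their classes, so each displayed set of pairs is a subset of $I\times I$. An action of $H$ on $I$ is a map $\diamond\colon H\times I\to I$ with $(h+h')\diamond y=h\diamond(h'\diamond y)$, $h\diamond(y+y')=h\diamond y+h\diamond y'$, $0\diamond y=y$. A 2-cocycle (for $\diamond$) is a pair $(\beta,f)$ of maps $H\times H\to I$, both vanishing when some argument is $0$, with $\beta$ symmetric, such that for all $a,b,c\in H$: $\beta(b,c)-\beta(a+b,c)+\beta(a,b+c)-\beta(a,b)=0$; $f(a,b+c)-f(a,b)-f(a,c)=a\diamond\beta(b,c)-\beta(b,c)$; $f(a+b,c)=b\diamond f(a,c)+f(b,c)$. It is a coboundary if there is $t\colon H\to I$ with $t(0)=0$, $\beta(a,b)=t(a)-t(a+b)+t(b)$ and $f(a,b)=t(b)-a\diamond t(b)$ for all $a,b$. The quotient group of 2-cocycles modulo coboundaries is $\operatorname{H}^2_\diamond(H,I)$. For $\gamma\in I$ and $0\le i,j<p^{\eta}$: $\alpha_1(\gamma)(i,j):=\gamma$ if $i+j\ge p^{\eta}$, and $0$ otherwise. For $f_0\in I$: $f_{f_0}(h,h'):=h'\sum_{j=0}^{h-1}(j\diamond f_0)$ for $0\le h,h'<p^{\eta}$. A set $\Lambda\subseteq I\times I$ ''parametrizes a complete family $(\alpha_1(\gamma),f_{f_0})$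 of representatives of 2-cocycles modulo coboundaries'' if $(\alpha_1(\gamma),f_{f_0})$ is a 2-cocycle for each $(f_0,\gamma)\in\Lambda$ and each class in $\operatorname{H}^2_\diamond(H,I)$ contains $(\alpha_1(\gamma),f_{f_0})$ for exactly one $(f_0,\gamma)\in\Lambda$. *)

(* Defs.v *)
From HB Require Import structures.
From mathcomp Require Import all_boot all_order all_algebra all_fingroup.
Set Implicit Arguments.
Unset Strict Implicit.
Unset Printing Implicit Defensive.
Import GRing.Theory FinRing.Theory.
Local Open Scope ring_scope.

Section Cohomology.
Variables H I : finZmodType.

Record zaction := ZAction {
  zact :> H -> I -> I;
  zactDl : forall h h' y, zact (h + h') y = zact h (zact h' y);
  zactDr : forall h y y', zact h (y + y') = zact h y + zact h y';
  zact0 : forall y, zact 0 y = y }.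

(* Pairs (beta, f) of maps H * H -> I, as a finite group under pointwise
   addition: in %g, products and inverses are sums and opposites. *)
Definition cochain2 : Type := ({ffun H * H -> I} * {ffun H * H -> I})%type.
HB.instance Definition _ := Finite.on cochain2.
HB.instance Definition _ := GRing.Zmodule.on cochain2.
HB.instance Definition _ := [finGroupMixin of cochain2 for +%R].

Variable dia : zaction.

(* These are the conditions for H with the trivial linear cycle set structure
   a . b = b; with that structure fixed, the operation no longer appears. *)
Definition cocycle2 (c : cochain2) : bool :=
  let: (beta, f) := c in
  [&& [forall a, [&& beta (a, 0) == 0, beta (0, a) == 0,
                     f (a, 0) == 0 & f (0, a) == 0]],
      [forall a, forall b, beta (a, b) == beta (b, a)],
      [forall a, forall b, forall c,
        beta (b, c) - beta (a + b, c) + beta (a, b + c) - beta (a, b) == 0],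
      [forall a, forall b, forall c,
        f (a, b + c) - f (a, b) - f (a, c)
          == dia a (beta (b, c)) - beta (b, c)] &
      [forall a, forall b, forall c,
        f (a + b, c) == dia b (f (a, c)) + f (b, c)]].

Definition coboundary2 (c : cochain2) : bool :=
  let: (beta, f) := c in
  [exists t : {ffun H -> I},
    [&& t 0 == 0,
        [forall a, forall b, beta (a, b) == t a - t (a + b) + t b] &
        [forall a, forall b, f (a, b) == t b - dia a (t b)]]].

Definition Z2 : {set cochain2} := [set c | cocycle2 c].
Definition B2 : {set cochain2} := [set c | coboundary2 c].

Fact zact_r0 a : dia a 0 = 0.
Proof. by apply: (addrI (dia a 0)); rewrite -zactDr !addr0. Qed.

Fact Z2_group_set : group_set Z2.
Proof.
apply/group_setP; split=> [|[b1 f1] [b2 f2]]; rewrite !inE.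
  rewrite /cocycle2 /=; apply/and5P; split.
  - by apply/forallP=> a; rewrite !ffunE eqxx.
  - by do 2![apply/forallP=> ?]; rewrite !ffunE.
  - by do 3![apply/forallP=> ?]; rewrite !ffunE !subr0 addr0.
  - by do 3![apply/forallP=> ?]; rewrite !ffunE !subr0 zact_r0.
  by do 3![apply/forallP=> ?]; rewrite !ffunE zact_r0 addr0.
move=> /and5P[/forallP n1 /'forall_'forall_eqP s1
  /'forall_'forall_'forall_eqP c1 /'forall_'forall_'forall_eqP d1
  /'forall_'forall_'forall_eqP e1].
move=> /and5P[/forallP n2 /'forall_'forall_eqP s2
  /'forall_'forall_'forall_eqP c2 /'forall_'forall_'forall_eqP d2
  /'forall_'forall_'forall_eqP e2].
apply/and5P; split.
- apply/forallP=> a; rewrite !ffunE.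
  have /and4P[/eqP-> /eqP-> /eqP-> /eqP->] := n1 a.
  by have /and4P[/eqP-> /eqP-> /eqP-> /eqP->] := n2 a; rewrite addr0 eqxx.
- by apply/'forall_'forall_eqP=> a b; rewrite !ffunE s1 s2.
- apply/'forall_'forall_'forall_eqP=> a b c; rewrite !ffunE.
  rewrite !opprD (addrACA (b1 (b, c))) (addrACA (b1 (b, c) - _)).
  by rewrite (addrACA (b1 (b, c) - _ + _)) c1 c2 addr0.
- apply/'forall_'forall_'forall_eqP=> a b c; rewrite !ffunE.
  rewrite zactDr !opprD (addrACA (f1 (a, b + c))).
  by rewrite (addrACA (f1 (a, b + c) - _)) d1 d2 addrACA.
apply/'forall_'forall_'forall_eqP=> a b c; rewrite !ffunE.
by rewrite zactDr e1 e2 addrACA.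
Qed.
Canonical Z2_group := Group Z2_group_set.

Fact B2_group_set : group_set B2.
Proof.
apply/group_setP; split=> [|[b1 f1] [b2 f2]]; rewrite !inE.
  apply/existsP; exists [ffun=> 0]; apply/and3P; split; rewrite ?ffunE //.
    by apply/'forall_'forall_eqP=> a b; rewrite !ffunE subr0 addr0.
  by apply/'forall_'forall_eqP=> a b; rewrite !ffunE zact_r0 subr0.
move=> /existsP[t1 /and3P[/eqP z1 /'forall_'forall_eqP c1 /'forall_'forall_eqP d1]].
move=> /existsP[t2 /and3P[/eqP z2 /'forall_'forall_eqP c2 /'forall_'forall_eqP d2]].
apply/existsP; exists (t1 + t2); apply/and3P; split.
- by rewrite ffunE z1 z2 addr0.
- apply/'forall_'forall_eqP=> a b; rewrite !ffunE c1 c2 opprD.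
  by rewrite (addrACA (t1 a)) (addrACA (t1 a - _)).
apply/'forall_'forall_eqP=> a b; rewrite !ffunE d1 d2 zactDr opprD.
by rewrite addrACA.
Qed.
Canonical B2_group := Group B2_group_set.

Definition H2 : {set coset_of B2} := (Z2 / B2)%g.

Definition parametrizes (c : I -> I -> cochain2) (L : {set I * I}) : Prop :=
  (forall x, x \in L -> c x.1 x.2 \in Z2) /\
  (forall C, C \in H2 -> exists! x, x \in L /\ c x.1 x.2 \in C).

End Cohomology.

(* For n > 1, the coercion from 'Z_n to nat yields the representative in
   {0, ..., n - 1}, so x.1 + x.2 below is a sum of natural numbers. *)
Definition alpha1 n (I : finZmodType) (gamma : I) : {ffun 'Z_n * 'Z_n -> I} :=
  [ffun x : 'Z_n * 'Z_n => if (n <= x.1 + x.2)%N then gamma else 0].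

Definition ffam n (I : finZmodType) (dia : zaction 'Z_n I) (f0 : I) :
    {ffun 'Z_n * 'Z_n -> I} :=
  [ffun x : 'Z_n * 'Z_n => (\sum_(0 <= j < x.1) dia j%:R f0) *+ x.2].

(* The elements of L are the pairs (f0, gamma), in this order. *)
Definition complete_family n (I : finZmodType) (dia : zaction 'Z_n I)
    (L : {set I * I}) : Prop :=
  parametrizes dia (fun f0 gamma => (alpha1 n gamma, ffam dia f0)) L.

(* Main.v *)
Require Import Defs.
From HB Require Import structures.
From mathcomp Require Import all_boot all_order all_algebra all_fingroup.
From mathcomp Require Import ring zify.
Set Implicit Arguments.
Unset Strict Implicit.
Unset Printing Implicit Defensive.
Import GRing.Theory.
Local Open Scope ring_scope.

(* Let w := 1 ⋄ 1, a unit of Z/q with w^m = 1, for m = p^eta and q = p^r, so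
that h ⋄ y = w^h y; Fermat gives w = 1 (mod p), i.e. w = 1 + pk. Hence the norm
1 + w + ... + w^(m-1) is divisible by p^eta, and so vanishes in Z/q.
Subtracting the coboundary of t(b) = - sum_(j < b) beta(j, 1) makes
beta(j, 1) = 0 for j < m - 1; the cocycle identities then give, by induction,
beta = alpha_1(gamma) with gamma = beta(m - 1, 1), and f = f_(f0) with
f0 = f(1, 1). The compatibility of f with beta on (1, m - 1, 1) amounts to
(w - 1) gamma = 0, because m f0 = 0. A pair (alpha_1(gamma), f_(f0)) is a
coboundary iff gamma = 0 and f0 lies in (w - 1) Z/q. So the classes correspond
to Z/q modulo (w - 1), times the annihilator of w - 1, where w - 1 = pk. *)

(** * Residues and their integer representatives *)

Lemma val_ZpD m (a b : 'Z_m) : (1 < m)%N -> (a + b : 'Z_m) = ((a + b) %% m)%N :> nat.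
Proof. by move=> m_gt1; rewrite -val_Zp_nat // natrD !natr_Zp. Qed.

Lemma ltn_Zp m (a : 'Z_m) : (1 < m)%N -> (a < m)%N.
Proof. by move=> m_gt1; rewrite -[a]natr_Zp val_Zp_nat // ltn_mod ltnW. Qed.

Lemma Zp_natr_inj q a b : (1 < q)%N -> a%:R = b%:R :> 'Z_q <-> a = b %[mod q].
Proof.
move=> q_gt1; split=> [/(congr1 val) | eq_ab]; first by rewrite /= !val_Zp_nat.
by apply: val_inj; rewrite /= !val_Zp_nat.
Qed.

Lemma Zp_natr_eq0 q a : (1 < q)%N -> a%:R = 0 :> 'Z_q <-> (q %| a)%N.
Proof.
move=> q_gt1; rewrite -[0]/(0%:R) Zp_natr_inj // mod0n.
by split=> [/eqP|/eqP].
Qed.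

Lemma natr_modn_dvd q m a : (1 < q)%N -> (q %| m)%N -> (a %% m)%:R = a%:R :> 'Z_q.
Proof. by move=> q_gt1 q_dvd_m; apply/Zp_natr_inj; rewrite ?modn_dvdm. Qed.

(** * Geometric sums and their divisibility *)

Lemma geometric_sumD (R : pzSemiRingType) (x : R) a b :
  \sum_(0 <= j < a + b) x ^+ j
    = x ^+ b * (\sum_(0 <= j < a) x ^+ j) + \sum_(0 <= j < b) x ^+ j.
Proof.
rewrite addnC (@big_cat_nat _ _ _ b) /= ?leq_addr // addrC; congr (_ + _).
rewrite -{1}[b]add0n big_addn addKn mulr_sumr.
by apply: eq_bigr => j _; rewrite addnC exprD.
Qed.

Lemma geometric_sumM (R : comPzSemiRingType) (x : R) a b :
  \sum_(0 <= j < a * b) x ^+ j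
    = (\sum_(0 <= j < b) x ^+ j) * \sum_(0 <= j < a) (x ^+ b) ^+ j.
Proof.
elim: a => [|a IHa]; first by rewrite mul0n [LHS]big_nil [X in _ * X]big_nil mulr0.
rewrite mulSn geometric_sumD IHa big_nat_recr //= -exprM mulrDr addrC.
by rewrite [(b * a)%N]mulnC [X in _ + X]mulrC.
Qed.

(** Pascal's rule drives the induction; the sum is ((1 + x)^a - 1) / x without division, for the
    closed form of f. *)
Lemma geometric_sum1D (R : comPzSemiRingType) (x : R) a :
  \sum_(0 <= j < a) (1 + x) ^+ j = \sum_(0 <= l < a) x ^+ l *+ 'C(a, l.+1).
Proof.
elim: a => [|a IHa]; first by rewrite !big_geq.
rewrite big_nat_recr //= IHa exprDn.
rewrite [RHS](eq_bigr (fun l => x ^+ l *+ 'C(a, l.+1) + x ^+ l *+ 'C(a, l))).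
  rewrite big_split /= big_nat_recr //= bin_small // mulr0n addr0; congr (_ + _).
  by rewrite big_mkord; apply: eq_bigr => l _; rewrite expr1n mul1r.
by move=> l _; rewrite binS mulrnDr.
Qed.

(** The sum for e + 1 factors as the sum for e times a sum of p powers of x^(p^e); these powers are
    1 modulo p, so p divides the second factor. *)
Lemma dvdn_geometric_sum p x e :
  x = 1 %[mod p] -> (p ^ e %| \sum_(0 <= j < p ^ e) x ^ j)%N.
Proof.
move=> x1; elim: e => [|e IHe]; first exact: dvd1n.
rewrite expnS (geometric_sumM (x : nat) p (p ^ e)).
rewrite mulnC dvdn_mul // /dvdn big_mkord -modn_summ.
under eq_bigr => j _ do rewrite !natrXE -expnM -modnXm x1 modnXm exp1n.
by rewrite modn_summ sum_nat_const card_ord muln1 modnn.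
Qed.

(** * Cocycles, coboundaries and their classes *)

Section Cohomologous.
Variables (H I : finZmodType) (dia : zaction H I).

Lemma Z2P (beta f : {ffun H * H -> I}) : reflect
  [/\ forall a, [/\ beta (a, 0) = 0, beta (0, a) = 0, f (a, 0) = 0 & f (0, a) = 0],
      forall a b, beta (a, b) = beta (b, a),
      forall a b c, beta (b, c) - beta (a + b, c) + beta (a, b + c) - beta (a, b) = 0,
      forall a b c, f (a, b + c) - f (a, b) - f (a, c) = dia a (beta (b, c)) - beta (b, c) &
      forall a b c, f (a + b, c) = dia b (f (a, c)) + f (b, c)]
  (((beta, f) : cochain2 H I) \in Z2 dia).
Proof.
rewrite inE; apply: (iffP and5P) => -[n s c d e]; split.
- by move=> a; have /and4P[/eqP-> /eqP-> /eqP-> /eqP->] := forallP n a.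
- by move=> a b; apply/eqP; have /'forall_forallP := s; apply.
- exact/'forall_'forall_'forall_eqP.
- exact/'forall_'forall_'forall_eqP.
- exact/'forall_'forall_'forall_eqP.
- by apply/forallP=> a; have [-> -> -> ->] := n a; rewrite !eqxx.
- exact/'forall_'forall_eqP.
- exact/'forall_'forall_'forall_eqP.
- exact/'forall_'forall_'forall_eqP.
- exact/'forall_'forall_'forall_eqP.
Qed.

Lemma B2P (beta f : {ffun H * H -> I}) : reflect
  (exists t : {ffun H -> I},
    [/\ t 0 = 0, forall a b, beta (a, b) = t a - t (a + b) + t b &
        forall a b, f (a, b) = t b - dia a (t b)])
  (((beta, f) : cochain2 H I) \in B2 dia).
Proof.
rewrite inE; apply: (iffP existsP) => -[t]; last first.
  by case=> z c d; exists t; apply/and3P; split; [exact/eqP|exact/'forall_'forall_eqP..].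
by case/and3P=> /eqP z /'forall_'forall_eqP c /'forall_'forall_eqP d; exists t.
Qed.

Lemma zactN a y : dia a (- y) = - dia a y.
Proof. by apply: (addrI (dia a y)); rewrite -zactDr !subrr zact_r0. Qed.

Lemma B2_sub_Z2 : B2 dia \subset Z2 dia.
Proof.
apply/subsetP=> -[beta f] /B2P[t [t0 c d]]; apply/Z2P; split.
- by move=> a; rewrite !c !d add0r addr0 t0 zact0 zact_r0 !subrr addr0 sub0r addNr.
- by move=> a b; rewrite !c addrAC [b + a]addrC [t b - _ + _]addrAC [t b + _]addrC.
- move=> x y z; rewrite !c addrA !opprD !opprK !addrA.
  rewrite (ACl ((1*12)*(2*9)*(3*6)*(4*11)*(5*8)*(7*10)))%AC /=.
  by rewrite !subrr !addNr !addr0.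
- move=> x y z; rewrite !d !c !zactDr zactN !opprD !opprK !addrA.
  by rewrite [LHS](ACl (4*2*6*3*1*5))%AC.
move=> x y z; rewrite !d [x + y]addrC zactDl (zactDr dia y) zactN !addrA.
by rewrite [RHS](ACl ((1*4)*(3*2)))%AC /= subrr add0r.
Qed.

(** Cochain addition is commutative, so conjugation is trivial; [coset] can then be computed at any
    cochain. *)
Lemma cochain2_normB2 (c : cochain2 H I) : c \in 'N(B2 dia)%g.
Proof.
apply/normP; apply/setP=> x; rewrite mem_conjg.
suff -> : (x ^ c^-1)%g = x by [].
by rewrite conjgE [LHS]addrC; apply: mulgK.
Qed.

(** A coset of [B2] contains a representative exactly when they differ by a coboundary; this removes
    the quotient group. *)
Lemma parametrizesP (std : I -> I -> cochain2 H I) (L : {set I * I}) :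
  (forall x, x \in L -> std x.1 x.2 \in Z2 dia) ->
  (forall c, c \in Z2 dia -> exists! x, x \in L /\ c - std x.1 x.2 \in B2 dia) ->
  parametrizes dia std L.
Proof.
move=> stdZ uniq_std; split=> // C /morphimP[c _ /uniq_std[x [[xL cx] x_uniq]] ->].
have memC y : (std y.1 y.2 \in coset (B2 dia) c) = (c - std y.1 y.2 \in B2 dia).
  by rewrite val_coset ?cochain2_normB2 // mem_rcoset -groupV invMg invgK.
by exists x; split=> [|y]; rewrite memC //; apply: x_uniq.
Qed.

End Cohomologous.

(** Quotients by m count carries; this underlies the cocycle identity of [alpha1] and the induction
    determining beta. *)
Lemma divnDmr m x y : (0 < m)%N ->
  ((x + y) %/ m = (x + y %% m) %/ m + y %/ m)%N.
Proof. by move=> m_gt0; rewrite {1}(divn_eq y m) addnCA divnMDl // addnC. Qed.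

(** * Normal forms of cocycles for a cyclic group acting on Z/q *)

Section CyclicAction.
Variables (m q : nat) (dia : zaction 'Z_m 'Z_q).
Hypotheses (m_gt1 : (1 < m)%N) (q_gt1 : (1 < q)%N) (q_dvd_m : (q %| m)%N).

Let w : 'Z_q := dia 1 1.
(** The truncated norm of w: f_(f0)(a, b) is [geo a] times f0 b, and [geo m] is the full norm. *)
Let geo a : 'Z_q := \sum_(0 <= j < a) w ^+ j.

Lemma zact_mulr h y : dia h y = dia h 1 * y.
Proof.
rewrite -[y]natr_Zp; elim: (y : nat) => [|n IHn]; first by rewrite zact_r0 mulr0.
by rewrite -natr1 zactDr IHn mulrDr mulr1.
Qed.

Lemma zact_natr n y : dia n%:R y = w ^+ n * y.
Proof.
elim: n => [|n IHn]; first by rewrite zact0 mul1r.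
by rewrite -nat1r zactDl IHn zact_mulr mulrA exprS.
Qed.

Lemma zactE h y : dia h y = w ^+ h * y.
Proof. by rewrite -[in LHS](natr_Zp h) zact_natr. Qed.

Lemma zact1_expr_order : w ^+ m = 1.
Proof. by rewrite -[LHS]mulr1 -zact_natr pchar_Zp // zact0. Qed.

Lemma alpha1E (gamma : 'Z_q) (a b : 'Z_m) :
  alpha1 m gamma (a, b) = gamma *+ ((a + b) %/ m) :> 'Z_q.
Proof.
have a_lt := ltn_Zp a m_gt1; have b_lt := ltn_Zp b m_gt1.
rewrite ffunE /=; case: leqP => [le_m|lt_m]; last by rewrite divn_small.
suff -> : ((a + b) %/ m = 1)%N by [].
by apply/eqP; rewrite eqn_leq -ltnS ltn_divLR ?leq_divRL ?mul1n ?le_m ?(ltnW m_gt1) //; lia.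
Qed.

Lemma ffamE f0 a b : ffam dia f0 (a, b) = geo a * f0 * (b : nat)%:R.
Proof.
rewrite ffunE /= mulr_natr; congr (_ *+ _); rewrite mulr_suml.
by apply: eq_bigr => j _; rewrite zact_natr.
Qed.

Lemma alpha1B (gamma gamma' : 'Z_q) :
  alpha1 m (gamma - gamma') = alpha1 m gamma - alpha1 m gamma'.
Proof.
by apply/ffunP=> x; rewrite !ffunE; case: ifP => // _; rewrite subr0.
Qed.

Lemma ffamB f0 f1 : ffam dia (f0 - f1) = ffam dia f0 - ffam dia f1.
Proof.
apply/ffunP=> -[a b]; rewrite ffamE; have := ffamE f0 a b; have := ffamE f1 a b.
by move: (ffam _ f0) (ffam _ f1) => F0 F1; rewrite !ffunE => -> ->; ring.
Qed.

Hypothesis norm0 : geo m = 0.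

Lemma natr_ZpD (a b : 'Z_m) : (a + b)%R%:R = (a : nat)%:R + (b : nat)%:R :> 'Z_q.
Proof. by rewrite val_ZpD // natr_modn_dvd // natrD. Qed.

(** As the full norm vanishes, [geo] ignores multiples of m in its index, so the sum may be taken in
    the integers. *)
Lemma geo_ZpD (a b : 'Z_m) : geo (a + b)%R = w ^+ b * geo a + geo b.
Proof.
have geoD c d : geo (c + d) = w ^+ d * geo c + geo d by exact: geometric_sumD.
have geo_mul k : geo (k * m) = 0.
  by elim: k => [|k IHk]; [exact: big_nil|rewrite mulSn geoD norm0 IHk mulr0 addr0].
by rewrite -geoD [in RHS](divn_eq (a + b) m) geoD geo_mul mulr0 add0r val_ZpD.
Qed.

Lemma geo_mulB1 a : (w - 1) * geo a = w ^+ a - 1.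
Proof. by rewrite subrX1 /geo big_mkord. Qed.

(** As f is additive in its second argument, its compatibility with beta reduces to (w^a - 1) gamma
    = 0, and w^a - 1 is [geo a] times w - 1. *)
Lemma std_in_Z2 f0 gamma : (w - 1) * gamma = 0 ->
  ((alpha1 m gamma, ffam dia f0) : cochain2 'Z_m 'Z_q) \in Z2 dia.
Proof.
move=> w1gamma; apply/Z2P; split.
- move=> a; rewrite !alpha1E !ffamE /geo big_nil !mul0r mulr0.
  by rewrite addn0 add0n divn_small ?ltn_Zp.
- by move=> a b; rewrite !alpha1E addnC.
- move=> a b c; rewrite !alpha1E !val_ZpD //.
  have m_gt0 := ltnW m_gt1.
  rewrite (ACl ((1*3)*(2*4)))%AC /= -opprD -!mulrnDr.
  suff -> : ((b + c) %/ m + (a + (b + c) %% m) %/ m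
           = ((a + b) %% m + c) %/ m + (a + b) %/ m)%N by rewrite subrr.
  (* Both sides are the quotient of a + b + c by m. *)
  by rewrite addnC -divnDmr // [((a + b) %% m + c)%N]addnC -divnDmr //; congr (_ %/ _)%N; lia.
- move=> a b c; rewrite !ffamE natr_ZpD zactE.
  have -> : w ^+ a * alpha1 m gamma (b, c) - alpha1 m gamma (b, c)
     = geo a * ((w - 1) * gamma) *+ ((b + c) %/ m).
    by rewrite alpha1E mulrA [geo a * _]mulrC geo_mulB1 -mulrnAr mulrBl mul1r.
  by rewrite w1gamma; ring.
by move=> a b c; rewrite !ffamE geo_ZpD zactE; ring.
Qed.

(** Since beta(n, 1) = 0 for n + 1 < m, t(n) = n t(1) on representatives. The carry at m - 1 gives
    gamma = m t(1) = 0, and f(1, 1) gives f0 = (1 - w) t(1). *)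
Lemma std_coboundary f0 gamma :
  (((alpha1 m gamma, ffam dia f0) : cochain2 'Z_m 'Z_q) \in B2 dia) <->
  gamma = 0 /\ exists y, f0 = (w - 1) * y.
Proof.
split=> [/B2P[t [t0 c d]]|[-> [y ->]]].
  have tE n : (n < m)%N -> t n%:R = t 1 *+ n.
    elim: n => [|n IHn] n_lt; first by rewrite t0.
    have /eqP := c n%:R 1; rewrite alpha1E !val_Zp_nat // natr1.
    rewrite !modn_small ?(ltnW n_lt) // addn1 divn_small // mulr0n eq_sym addrAC.
    by rewrite subr_eq0 IHn ?(ltnW n_lt) // -mulrSr => /eqP->.
  have m_eq : (m.-1%:R + 1 : 'Z_m) = 0 by rewrite natr1 prednK ?(ltnW m_gt1) // pchar_Zp.
  split.
    have := c m.-1%:R 1; rewrite m_eq t0 subr0 tE ?ltn_predL ?(ltnW m_gt1) //.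
    rewrite -mulrSr prednK ?(ltnW m_gt1) // alpha1E !val_Zp_nat //.
    rewrite !modn_small ?ltn_predL ?(ltnW m_gt1) // addn1 prednK ?(ltnW m_gt1) //.
    rewrite divnn ?(ltnW m_gt1) // -[t 1 *+ m]mulr_natr.
    by have /(Zp_natr_eq0 _ q_gt1)-> := q_dvd_m; rewrite mulr0.
  exists (- t 1); have := d 1 1; rewrite ffamE zactE.
  have -> : (1 : 'Z_m) = 1%N :> nat by [].
  by rewrite /geo big_nat1 mulr1 mul1r => ->; ring.
(* Conversely, t(b) = - y b is additive because q divides m, so its coboundary has beta = 0. *)
apply/B2P; exists [ffun b : 'Z_m => - y * (b : nat)%:R]; split.
- by rewrite ffunE mulr0.
- by move=> a b; rewrite alpha1E mul0rn !ffunE natr_ZpD; ring.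
move=> a b; rewrite ffamE zactE !ffunE.
transitivity ((w - 1) * geo a * (y * (b : nat)%:R)); first by rewrite /geo; ring.
by rewrite geo_mulB1; ring.
Qed.

Lemma Z2_std (beta f : {ffun 'Z_m * 'Z_m -> 'Z_q}) : ((beta, f) : cochain2 'Z_m 'Z_q) \in Z2 dia ->
  (forall n, (n.+1 < m)%N -> beta (n%:R, 1) = 0) ->
  exists f0 gamma, (w - 1) * gamma = 0 /\ (beta, f) = (alpha1 m gamma, ffam dia f0).
Proof.
move=> /Z2P[n s c d e] beta1.
have m_gt0 := ltnW m_gt1.
set gamma : 'Z_q := beta (m.-1%:R, 1); set f0 : 'Z_q := f (1, 1).
have m1E : (m.-1%:R + 1 : 'Z_m) = 0 by rewrite natr1 prednK ?pchar_Zp.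
(* Stated for every natural x, as it is applied to a + k, which may reach m or exceed it. *)
have betaS x : beta (x%:R, 1) = gamma *+ ((x %% m).+1 %/ m).
  rewrite -[x%:R](natr_modn_dvd _ m_gt1 (dvdnn m)).
  have := ltn_pmod x m_gt0; rewrite leq_eqVlt => /predU1P[xm|xm].
    by have /= xE := congr1 predn xm; rewrite xE prednK // divnn m_gt0.
  by rewrite beta1 // divn_small.
have betaE a b : beta (a, b) = alpha1 m gamma (a, b).
  rewrite alpha1E -[in LHS](natr_Zp a) -[in LHS](natr_Zp b).
  have := ltn_Zp b m_gt1; elim: (b : nat) => [|k IHk] k_lt.
    by have [-> _ _ _] := n (a : nat)%:R; rewrite addn0 divn_small ?ltn_Zp.
  (* This gives beta(a, k + 1) = beta(a, k) + beta(a + k, 1), as beta(k, 1) = 0 for k + 1 < m. *)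
  have /eqP := c (a : nat)%:R k%:R 1.
  rewrite natr1 -natrD !betaS IHk ?(ltnW k_lt) // modn_small ?(ltnW k_lt) //.
  rewrite [(k.+1 %/ m)%N]divn_small // mulr0n sub0r subr_eq0 addrC subr_eq => /eqP->.
  by rewrite addnS -[(a + k).+1]add1n (divnDmr 1 (a + k)) // add1n !mulrnDr addrC.
have f1E k : (k < m)%N -> f (1, k%:R) = f0 *+ k.
  elim: k => [|k IHk] k_lt; first by have [_ _ -> _] := n 1.
  have := d 1 k%:R 1; rewrite beta1 // zact_r0 subr0 natr1 IHk ?(ltnW k_lt) // -addrA -opprD.
  by rewrite -mulrSr => /eqP; rewrite subr_eq0 => /eqP.
have fE a b : f (a, b) = ffam dia f0 (a, b).
  rewrite ffamE -[in LHS](natr_Zp a); elim: (a : nat) => [|k IHk].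
    by have [_ _ _ ->] := n b; rewrite /geo big_nil !mul0r.
  rewrite -natr1 e IHk zactE expr1 -{2}[b]natr_Zp f1E ?ltn_Zp //.
  rewrite /geo -[k.+1]addn1 geometric_sumD big_nat1 expr1 -[f0 *+ _]mulr_natr; ring.
exists f0, gamma; split; last by congr (_, _); apply/ffunP => -[a b].
have := d 1 m.-1%:R 1; rewrite m1E -/gamma f1E ?ltn_predL // zact_mulr -/w.
have [_ _ -> _] := n 1; rewrite sub0r -opprD -mulrSr prednK // -mulr_natr.
by have /(Zp_natr_eq0 _ q_gt1)-> := q_dvd_m; rewrite mulr0 oppr0 mulrBl mul1r => <-.
Qed.

Lemma Z2_normalize c : c \in Z2 dia -> exists f0 gamma,
  (w - 1) * gamma = 0 /\
  c - ((alpha1 m gamma, ffam dia f0) : cochain2 'Z_m 'Z_q) \in B2 dia.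
Proof.
case: c => beta f cZ; have m_gt0 := ltnW m_gt1.
(* For k + 1 < m, t(k) - t(k + 1) = beta(k, 1), and t(1) = - beta(0, 1) = 0; so the coboundary of t
   agrees with beta at (k, 1). *)
pose t := [ffun b : 'Z_m => - \sum_(0 <= j < b) beta (j%:R, 1)].
pose b := [ffun x : 'Z_m * 'Z_m => t x.1 - t (x.1 + x.2) + t x.2].
pose g := [ffun x : 'Z_m * 'Z_m => t x.2 - dia x.1 (t x.2)].
have bB : ((b, g) : cochain2 'Z_m 'Z_q) \in B2 dia.
  apply/B2P; exists t; split=> [|x y|x y].
  - by rewrite /t ffunE big_nil oppr0.
  - by rewrite /b ffunE.
  by rewrite /g ffunE.
have [||f0 [gamma [w1gamma E]]] := @Z2_std (beta - b) (f - g).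
- exact: groupM cZ (groupVr (subsetP (B2_sub_Z2 dia) _ bB)).
- move=> k k_lt; rewrite !ffunE natr1 !val_Zp_nat //.
  rewrite !modn_small ?(ltnW k_lt) // big_nat_recr //= big_nat1.
  have /Z2P[n _ _ _ _] := cZ; have [_ -> _ _] := n 1.
  by rewrite oppr0; ring.
exists f0, gamma; split=> //; rewrite -E.
suff -> : ((beta, f) : cochain2 'Z_m 'Z_q) - (beta - b, f - g) = (b, g) by [].
by congr (_, _); rewrite /= subKr.
Qed.

(** By the normal form only arithmetic in Z/q remains: gamma ranges over the annihilator of w - 1,
    and f0 over residues modulo w - 1. *)
Lemma complete_family_transversal (L : {set 'Z_q * 'Z_q}) :
  (forall x, x \in L -> (w - 1) * x.2 = 0) ->
  (forall f0 gamma, (w - 1) * gamma = 0 -> exists! x,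
     x \in L /\ x.2 = gamma /\ exists y, f0 - x.1 = (w - 1) * y) ->
  complete_family dia L.
Proof.
move=> L_ann L_uniq; apply: parametrizesP => [x xL|c /Z2_normalize].
  exact/std_in_Z2/L_ann.
case=> f0 [gamma [w1gamma cB]].
have stdB x : c - ((alpha1 m x.2, ffam dia x.1) : cochain2 'Z_m 'Z_q) \in B2 dia <->
    x.2 = gamma /\ exists y, f0 - x.1 = (w - 1) * y.
  (* Normal forms are additive in (f0, gamma), so the difference is a known coboundary plus a normal
     form. *)
  have -> : c - ((alpha1 m x.2, ffam dia x.1) : cochain2 'Z_m 'Z_q)
     = (c - ((alpha1 m gamma, ffam dia f0) : cochain2 'Z_m 'Z_q))
       + ((alpha1 m (gamma - x.2), ffam dia (f0 - x.1)) : cochain2 'Z_m 'Z_q).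
    rewrite alpha1B ffamB.
    suff -> : (alpha1 m gamma - alpha1 m x.2, ffam dia f0 - ffam dia x.1)
       = ((alpha1 m gamma, ffam dia f0) : cochain2 'Z_m 'Z_q)
         - ((alpha1 m x.2, ffam dia x.1) : cochain2 'Z_m 'Z_q) by rewrite addrA subrK.
    by [].
  rewrite (groupMl _ cB) std_coboundary.
  by split=> -[E ?]; split=> //; [apply/esym/eqP; rewrite -subr_eq0 E|rewrite E subrr].
have [x [[xL xE] x_uniq]] := L_uniq f0 gamma w1gamma.
exists x; split=> [|y [yL /stdB yE]]; first by split=> //; apply/stdB.
exact: x_uniq.
Qed.

End CyclicAction.

(** * The multiplier w = 1 + pk and the explicit families *)

Lemma eq1_mod_expn_prime p x e : prime p -> x ^ (p ^ e) = 1 %[mod p] -> x = 1 %[mod p].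
Proof.
move=> p_pr; elim: e => [|e IHe]; first by rewrite expn1.
by rewrite expnS mulnC expnM fermat_little.
Qed.

(** With v = u + 1, this identifies the annihilator of w - 1 = p^v s as the multiples of p^(r -
    v). *)
Lemma dvdn_coprime_expn p v r s g : (v <= r)%N -> (0 < p)%N -> coprime p s ->
  (p ^ r %| p ^ v * s * g)%N = (p ^ (r - v) %| g)%N.
Proof.
move=> v_le p_gt0 ps.
by rewrite -{1}(subnKC v_le) expnD -mulnA dvdn_pmul2l ?expn_gt0 ?p_gt0 // Gauss_dvdr ?coprimeXl.
Qed.

(** Reducing w^(p^eta) = 1 modulo p gives w = 1 modulo p by Fermat; k is the quotient by p of the
    representative of w. *)
Lemma zact1_decomposition p eta r (dia : zaction 'Z_(p ^ eta) 'Z_(p ^ r)) :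
  prime p -> (0 < eta)%N -> (0 < r)%N ->
  exists2 k : nat, (k < p ^ (r - 1))%N & dia 1 1 = (1 + p * k)%N%:R.
Proof.
move=> p_pr eta_gt0 r_gt0; have p_gt1 := prime_gt1 p_pr; have p_gt0 := ltnW p_gt1.
have m_gt1 : (1 < p ^ eta)%N by rewrite -(exp1n eta) ltn_exp2r.
have q_gt1 : (1 < p ^ r)%N by rewrite -(exp1n r) ltn_exp2r.
set x : nat := dia 1 1.
have x1 : x = 1 %[mod p].
  apply: (@eq1_mod_expn_prime p x eta) => //.
  have : (x ^ (p ^ eta))%:R = 1%:R :> 'Z_(p ^ r).
    by rewrite natrX natr_Zp (zact1_expr_order dia m_gt1).
  move/(Zp_natr_inj _ _ q_gt1)/(congr1 (modn^~ p)).
  by rewrite !modn_dvdm // dvdn_exp.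
have xE : (x = 1 + p * (x %/ p))%N.
  by rewrite [LHS](divn_eq x p) x1 modn_small // addnC mulnC.
exists (x %/ p)%N; last by rewrite -xE natr_Zp.
rewrite -(@ltn_pmul2l p) // -expnS subn1 prednK //.
by apply: leq_trans (ltn_Zp (dia 1 1) q_gt1); rewrite -/x {2}xE.
Qed.

Theorem proposition4p5 (p eta r : nat) (p_pr : prime p)
    (eta_ge1 : (1 <= eta)%N) (r_ge1 : (1 <= r)%N)
    (r_odd : odd p -> (r <= eta)%N)
    (r_two : p = 2%N -> (r <= minn 2 eta)%N)
    (dia : zaction 'Z_(p ^ eta) 'Z_(p ^ r)) :
  exists k : nat,
    [/\ (k < p ^ (r - 1))%N,
        forall (h : 'Z_(p ^ eta)) (y : 'Z_(p ^ r)),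
          dia h y = ((1 + p * k) ^ h)%N%:R * y /\
          ((1 + p * k) ^ h)%N%:R * y =
            \sum_(0 <= i < h.+1) ('C(h, i) * p ^ i * k ^ i)%N%:R * y,
        k = 0%N ->
          complete_family dia
            [set ((z1 : nat)%:R, (z2 : nat)%:R)
               | z1 : 'I_(p ^ r), z2 : 'I_(p ^ r)] /\
          (forall (f0 : 'Z_(p ^ r)) (h h' : 'Z_(p ^ eta)),
             ffam dia f0 (h, h') = f0 * (h : nat)%:R * (h' : nat)%:R) &
        k <> 0%N ->
          exists u s : nat,
            [/\ k = (p ^ u * s)%N, (u < r - 1)%N, ~~ (p %| s)%N,
                complete_family dia
                  [set ((z1 : nat)%:R, (p ^ (r - u - 1) * z2)%N%:R)
                     | z1 : 'I_(p ^ u.+1), z2 : 'I_(p ^ u.+1)] &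
                forall (f0 : 'Z_(p ^ r)) (h h' : 'Z_(p ^ eta)),
                  ffam dia f0 (h, h') =
                    \sum_(0 <= l < h)
                      ('C(h, l.+1) * p ^ (u.+1 * l) * s ^ l)%N%:R
                        * f0 * (h' : nat)%:R]].
Proof.
have [k k_lt wE] := zact1_decomposition dia p_pr eta_ge1 r_ge1.
have p_gt1 := prime_gt1 p_pr; have p_gt0 := ltnW p_gt1.
have m_gt1 : (1 < p ^ eta)%N by rewrite -(exp1n eta) ltn_exp2r.
have q_gt1 : (1 < p ^ r)%N by rewrite -(exp1n r) ltn_exp2r.
have r_le : (r <= eta)%N.
  by have [/r_two|/r_odd//] := even_prime p_pr; rewrite leq_min => /andP[].
have q_dvd_m : (p ^ r %| p ^ eta)%N by rewrite dvdn_exp2l.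
have w1E : dia 1 1 - 1 = (p * k)%N%:R by rewrite wE -nat1r addrAC subrr add0r.
have norm0 : \sum_(0 <= j < p ^ eta) dia 1 1 ^+ j = 0.
  have -> : \sum_(0 <= j < p ^ eta) dia 1 1 ^+ j
     = (\sum_(0 <= j < p ^ eta) (1 + p * k) ^ j)%N%:R.
    by rewrite natr_sum; apply: eq_bigr => j _; rewrite natrX wE.
  apply/(Zp_natr_eq0 _ q_gt1)/(dvdn_trans q_dvd_m)/dvdn_geometric_sum.
  by rewrite mulnC addnC modnMDl.
exists k; split=> // [h y|k0|/eqP].
- split; first by rewrite zactE // wE natrX.
  rewrite -mulr_suml -natr_sum big_mkord expnDn; congr (_%:R * _).
  by apply: eq_bigr => i _; rewrite exp1n mul1n expnMn mulnA.
(* Here w - 1 = 0: distinct values of f0 stay inequivalent and every gamma is annihilated. *)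
- have w1 : dia 1 1 = 1 by apply/eqP; rewrite -subr_eq0 w1E k0 muln0.
  split.
    apply: complete_family_transversal => // [x _|f0 gamma _].
      by rewrite w1 subrr mul0r.
    exists (f0, gamma); split=> [|[y1 y2] /= [_ [-> [z]]]].
      split; last by split=> //; exists 0; rewrite subrr mulr0.
      apply/imset2P; exists (Ordinal (ltn_Zp f0 q_gt1)) (Ordinal (ltn_Zp gamma q_gt1)) => //=.
      by rewrite !natr_Zp.
    by rewrite w1 subrr mul0r => /eqP; rewrite subr_eq0 => /eqP->.
  move=> f0 h h'; rewrite ffamE //; congr (_ * _); rewrite mulrC; congr (_ * _).
  rewrite w1; under eq_bigr => j _ do rewrite expr1n.
  by rewrite sumr_const_nat subn0.
(* Here u is the p-adic valuation of k and s its cofactor prime to p, so w - 1 = p^(u + 1) s. *)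
rewrite -lt0n => k_gt0; have [s ps kE] := pfactor_coprime p_pr k_gt0.
set u := logn p k in kE; rewrite mulnC in kE.
have u_lt : (u < r - 1)%N.
  rewrite -(ltn_exp2l _ _ p_gt1); apply: leq_ltn_trans k_lt.
  by rewrite kE leq_pmulr //; move: k_gt0; rewrite kE muln_gt0 => /andP[].
have pkE : (p * k = p ^ u.+1 * s)%N by rewrite kE mulnA expnS.
have v_lt : (u.+1 < r)%N by rewrite -[u.+1]add1n -ltn_subRL.
have w1gE g : (dia 1 1 - 1) * g%:R = 0 <-> (p ^ (r - u.+1) %| g)%N.
  by rewrite w1E -natrM Zp_natr_eq0 // pkE dvdn_coprime_expn // ltnW.
exists u, s; split=> //; first by rewrite -prime_coprime.
  rewrite -subnDA addn1.
  apply: complete_family_transversal => // [x /imset2P[z1 z2 _ _ ->]|f0 gamma].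
    by apply/w1gE; rewrite dvdn_mulr.
  rewrite -[gamma]natr_Zp => /w1gE g_dvd.
  have z1_lt : (f0 %% p ^ u.+1 < p ^ u.+1)%N by rewrite ltn_mod expn_gt0 p_gt0.
  have z2_lt : (gamma %/ p ^ (r - u.+1) < p ^ u.+1)%N.
    rewrite ltn_divLR ?expn_gt0 ?p_gt0 // -expnD subnKC ?ltn_Zp //; exact: ltnW.
  (* f0 is reduced modulo p^(u + 1), which generates the same ideal as w - 1; gamma is kept, with
     its quotient by p^(r - u - 1) as index. *)
  exists ((Ordinal z1_lt : nat)%:R, gamma); split.
    split; first apply/imset2P.
      exists (Ordinal z1_lt) (Ordinal z2_lt) => //=.
      by rewrite mulnC divnK // natr_Zp.
    (* f0 minus its remainder is p^(u + 1) times the quotient; the inverse of s cancels the factor s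
       of w - 1. *)
    rewrite natr_Zp; split=> //=; exists ((s%:R : 'Z_(p ^ r))^-1 * (f0 %/ p ^ u.+1)%:R).
    have s_unit : (s%:R : 'Z_(p ^ r)) \is a GRing.unit by rewrite unitZpE // coprimeXl.
    rewrite w1E pkE natrM -mulrA mulVKr // -[X in X - _]natr_Zp [in X in X - _](divn_eq f0 (p ^ u.+1)).
    by rewrite natrD addrK mulnC natrM.
  move=> [y1 y2] /= [/imset2P[z1 z2 _ _ [-> ->]] [-> [y]]]; rewrite natr_Zp => f0E.
  congr (_%:R, _).
  (* The equation in Z/p^r descends modulo p^(u + 1), where w - 1 vanishes; z1 is already
     reduced. *)
  suff : f0 = z1 %[mod p ^ u.+1] by rewrite [in RHS]modn_small.
  move/eqP: f0E; rewrite subr_eq w1E pkE -[f0]natr_Zp -[y]natr_Zp -natrM -natrD.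
  move/eqP/(Zp_natr_inj _ _ q_gt1)/(congr1 (modn^~ (p ^ u.+1)%N)).
  rewrite !modn_dvdm ?dvdn_exp2l 1?ltnW // !val_Zp_nat // modn_dvdm ?dvdn_exp2l 1?ltnW // => ->.
  by rewrite -mulnA mulnC modnMDl.
move=> f0 h h'; rewrite ffamE // wE -nat1r geometric_sum1D !mulr_suml.
apply: eq_bigr => l _; rewrite -natrX pkE expnMn -expnM -mulr_natl -natrM.
by rewrite !mulnA.
Qed.
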